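(* Let $0\le\Omega_\Lambda\le1$, $z_0>0$, $c>0$, $E(r)=r^2/2$, $R_0(r)=cr$ and $R[z]=R_{\Omega_\Lambda}[z]$. If $z_0\ne z_\Lambda$, then a smooth solution $\vec X=(r,t,M)^T$, on an open interval containing $z_0$, of the system $$\frac{dr}{dz}=\frac{\mathcal G A R}{\mathcal G E'R-\mathcal F}-\frac{R_z\,(M\mathcal G-R)\sqrt{1+2E}}{R\,(\delta\sigma\sqrt{2E+2M/R}-\sqrt{1+2E})(\mathcal G E'R-\mathcal F)},$$ $$\frac{dt}{dz}=\frac{\delta R_z}{\delta\sigma\sqrt{2E+2M/R}-\sqrt{1+2E}},$$ $$\frac{dM}{dz}=\frac{-\mathcal F R A}{\mathcal G E'R-\mathcal F}-\frac{R_z\,(R^2E'-\mathcal F M)\sqrt{1+2E}}{R\,(\delta\sigma\sqrt{2E+2M/R}-\sqrt{1+2E})(\mathcal G E'R-\mathcal F)}$$ with initial conditions $$\vec X(z_0)=\left(\frac{R[z_0]}{c},\ \sqrt2\,k_c,\ \frac12\left(\frac{R[z_0]}{c}\right)^3\right)^T$$ is unique (locally near $z_0$).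
   Context: For $0\le\Omega_\Lambda\le1$ let $\mathcal I(y)=1/\sqrt{\Omega_\Lambda+(1-\Omega_\Lambda)y^3}$ and $R_{\Omega_\Lambda}[z]=\frac1{1+z}\int_1^{1+z}\mathcal I(y)\,dy$; $R_z=dR[z]/dz$. For $0\le\Omega_\Lambda<1$, $z_\Lambda$ is the unique positive zero of $R_z$; for $\Omega_\Lambda=1$ there is no such zero and the condition $z_0\ne z_\Lambda$ is vacuous. For $c>0$, $k_c=\sqrt{c+c^2}$. A prime denotes $d/dr$. In the system, $R=R[z]$, $E=E(r(z))$, $E'=E'(r(z))$, $R_0=R_0(r(z))$, $R_0'=R_0'(r(z))$, and $\sigma=\delta=1$ (corresponding to $\partial_tR>0$, $\partial_rR>0$). Set $$B=\frac{\sigma\sqrt{2E+2M/R}}{1+z},\qquad A=B\sqrt{1+2E},$$ $$J(R,R_0,M,E,t)=\sqrt2(t-t_0)-\sigma\int_{R_0}^R\sqrt{\frac{\tau}{\tau E+M}}\,d\tau ,\qquad t_0=\sqrt2\,k_c,$$ and define $\mathcal F,\mathcal G$ by $-(\partial_RJ)\mathcal F=E'\partial_EJ+R_0'\partial_{R_0}J$ and $-(\partial_RJ)\mathcal G=\partial_MJ$. A solution is understood to be one for which all denominators in the system are non-zero. *)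

(* Defs.v *)
From Stdlib Require Import Reals.
From Coquelicot Require Import Coquelicot.
Open Scope R_scope.

(* Stdlib reals with Coquelicot: [Derive] and [RInt] are total, and [RInt f a b]
   is the oriented integral, so b < a is allowed. *)

(** The areal radius R[z] (Rof) along the past light cone *)

Definition calI (OL y : R) : R := 1 / sqrt (OL + (1 - OL) * y ^ 3).

Definition Rof (OL z : R) : R := 1 / (1 + z) * RInt (calI OL) 1 (1 + z).

Definition R_z (OL z : R) : R := Derive (Rof OL) z.

(* For OL = 1 no zL satisfies this. *)
Definition is_zLambda (OL zL : R) : Prop :=
  unique (fun z => 0 < z /\ R_z OL z = 0) zL.

(** The function J and the quantities defined from it *)

(* The signs of the r- and t-derivatives of the areal radius. *)
Definition sigma : R := 1.
Definition delta : R := 1.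

Definition kc (c : R) : R := sqrt (c + c ^ 2).

Definition t0 (c : R) : R := sqrt 2 * kc c.

Definition J (c Rv R0 M E t : R) : R :=
  sqrt 2 * (t - t0 c)
  - sigma * RInt (fun tau => sqrt (tau / (tau * E + M))) R0 Rv.

Definition dJ_R (c Rv R0 M E t : R) : R := Derive (fun x => J c x R0 M E t) Rv.
Definition dJ_R0 (c Rv R0 M E t : R) : R := Derive (fun x => J c Rv x M E t) R0.
Definition dJ_M (c Rv R0 M E t : R) : R := Derive (fun x => J c Rv R0 x E t) M.
Definition dJ_E (c Rv R0 M E t : R) : R := Derive (fun x => J c Rv R0 M x t) E.

(* - dJ_R * calF = E' * dJ_E + R0' * dJ_R0  and  - dJ_R * calG = dJ_M, solved
   for calF and calG; E and R0 are here functions of r. *)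
Definition calF (c : R) (E R0 : R -> R) (Rv r t M : R) : R :=
  (Derive E r * dJ_E c Rv (R0 r) M (E r) t
   + Derive R0 r * dJ_R0 c Rv (R0 r) M (E r) t)
  / - dJ_R c Rv (R0 r) M (E r) t.

Definition calG (c : R) (E R0 : R -> R) (Rv r t M : R) : R :=
  dJ_M c Rv (R0 r) M (E r) t / - dJ_R c Rv (R0 r) M (E r) t.

Definition Bcoef (E : R -> R) (Rv z r M : R) : R :=
  sigma * sqrt (2 * E r + 2 * M / Rv) / (1 + z).

Definition Acoef (E : R -> R) (Rv z r M : R) : R :=
  Bcoef E Rv z r M * sqrt (1 + 2 * E r).

(** The system of ordinary differential equations *)

(* delta sigma sqrt(2E + 2M/R) - sqrt(1 + 2E) *)
Definition den1 (E : R -> R) (Rv r M : R) : R :=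
  delta * sigma * sqrt (2 * E r + 2 * M / Rv) - sqrt (1 + 2 * E r).

(* G E' R - F *)
Definition den2 (c : R) (E R0 : R -> R) (Rv r t M : R) : R :=
  calG c E R0 Rv r t M * Derive E r * Rv - calF c E R0 Rv r t M.

Definition rhs_r (OL c : R) (E R0 : R -> R) (z r t M : R) : R :=
  let Rv := Rof OL z in
  let G := calG c E R0 Rv r t M in
  let A := Acoef E Rv z r M in
  G * A * Rv / den2 c E R0 Rv r t M
  - R_z OL z * (M * G - Rv) * sqrt (1 + 2 * E r)
    / (Rv * den1 E Rv r M * den2 c E R0 Rv r t M).

Definition rhs_t (OL : R) (E : R -> R) (z r M : R) : R :=
  delta * R_z OL z / den1 E (Rof OL z) r M.

Definition rhs_M (OL c : R) (E R0 : R -> R) (z r t M : R) : R :=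
  let Rv := Rof OL z in
  let F := calF c E R0 Rv r t M in
  let A := Acoef E Rv z r M in
  - F * Rv * A / den2 c E R0 Rv r t M
  - R_z OL z * (Rv ^ 2 * Derive E r - F * M) * sqrt (1 + 2 * E r)
    / (Rv * den1 E Rv r M * den2 c E R0 Rv r t M).

(* 1 + z occurs in Bcoef and Rof, and dJ_R in calF and calG. *)
Definition denominators_nonzero (OL c : R) (E R0 : R -> R) (z r t M : R) : Prop :=
  let Rv := Rof OL z in
  1 + z <> 0 /\ Rv <> 0 /\ dJ_R c Rv (R0 r) M (E r) t <> 0 /\
  den1 E Rv r M <> 0 /\ den2 c E R0 Rv r t M <> 0.

Definition in_open (a b : Rbar) (z : R) : Prop := Rbar_lt a z /\ Rbar_lt z b.

Definition smooth_on (a b : Rbar) (f : R -> R) : Prop :=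
  forall (n : nat) (z : R), in_open a b z -> ex_derive_n f n z.

(* (r, t, M) solves the system on the open interval (a, b); the values outside
   (a, b) play no role. *)
Definition smooth_solution (OL c : R) (E R0 : R -> R) (a b : Rbar)
    (r t M : R -> R) : Prop :=
  smooth_on a b r /\ smooth_on a b t /\ smooth_on a b M /\
  forall z : R, in_open a b z ->
    denominators_nonzero OL c E R0 z (r z) (t z) (M z) /\
    is_derive r z (rhs_r OL c E R0 z (r z) (t z) (M z)) /\
    is_derive t z (rhs_t OL E z (r z) (M z)) /\
    is_derive M z (rhs_M OL c E R0 z (r z) (t z) (M z)).

Definition initial_condition (OL c z0 : R) (r t M : R -> R) : Prop :=
  r z0 = Rof OL z0 / c /\
  t z0 = sqrt 2 * kc c /\
  M z0 = 1 / 2 * (Rof OL z0 / c) ^ 3.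

(* Main.v *)
From Stdlib Require Import Reals Lra Psatz.
From Coquelicot Require Import Coquelicot.
Require Import Defs.
Open Scope R_scope.

(** The theorem is the uniqueness half of the Cauchy-Lipschitz theorem. What has
    to be checked is that the right-hand side of the system, which is built from
    derivatives of an integral, is Lipschitz in the state (r, t, M) near the
    initial point, uniformly in z.

    The initial data put the state at R_0(r) = R[z_0], so the integral defining J
    runs over an interval that is short near the initial point and that stays
    close to R[z_0] > 0. There E > 0 and M > 0, so its integrand is smooth, the
    partial derivatives of J with respect to the endpoints are values of the
    integrand ([dJ_R_eq], [dJ_R0_eq]), and those with respect to M and E are
    integrals of an explicit algebraic function ([dJ_M_eq], [dJ_E_eq]). All other
    ingredients are algebraic in r and M, or functions of z alone which are
    continuous since R[z] is C^1.

    It is therefore enough to have a class of functions f(z, X) that are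
    continuous at the base point and Lipschitz in X near it ([lip_at]), and that
    is closed under arithmetic, square roots and integration between variable
    endpoints ([lip_at_RInt]). Quotients need a non-zero denominator only at the
    base point, and this is part of what a solution is.

    Uniqueness then comes from Gronwall's inequality ([gronwall_zero]) applied to
    the squared distance of two solutions ([ode_unique]). *)

(** * Functions that are locally Lipschitz in the state *)

(** Joint continuity is asked for at the base point only. Together with the
    Lipschitz bound it keeps f(z, X) close to f(z0, X0), which is what inverses,
    square roots and products need; away from z0, dependence on z may be
    arbitrary. *)
Definition lip_at {V : NormedModule R_AbsRing} (z0 : R) (X0 : V)
    (f : R -> V -> R) : Prop :=
  continuous (fun p : R * V => f (fst p) (snd p)) (z0, X0) /\
  exists K, 0 <= K /\ exists e : posreal, forall z X Y,
    ball z0 e z -> ball X0 e X -> ball X0 e Y ->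
    Rabs (f z X - f z Y) <= K * norm (minus X Y).

Lemma min_posreal (a b : posreal) :
  exists e : posreal, e <= a /\ e <= b.
Proof.
  exists (mkposreal _ (Rmin_stable_in_posreal a b)); simpl.
  split; [apply Rmin_l | apply Rmin_r].
Qed.

Lemma Rabs_RInt_le (h : R -> R) (a b B : R) :
  (forall x, Rmin a b <= x <= Rmax a b -> continuous h x) ->
  (forall x, Rmin a b <= x <= Rmax a b -> Rabs (h x) <= B) ->
  Rabs (RInt h a b) <= B * Rabs (b - a).
Proof.
  intros Hc HB.
  destruct (Rle_or_lt a b) as [Hab|Hab].
  - rewrite Rmin_left, Rmax_right in * by lra.
    rewrite (Rabs_right (b - a)) by lra. rewrite Rmult_comm.
    apply abs_RInt_le_const; [lra| |exact HB].
    apply (ex_RInt_continuous (V := R_CompleteNormedModule)).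
    rewrite Rmin_left, Rmax_right by lra. exact Hc.
  - rewrite Rmin_right, Rmax_left in * by lra.
    rewrite (Rabs_left (b - a)) by lra.
    rewrite <- (opp_RInt_swap (V := R_CompleteNormedModule)).
    + change (Rabs (- RInt h b a) <= B * - (b - a)). rewrite Rabs_Ropp.
      replace (B * - (b - a)) with ((a - b) * B) by ring.
      apply abs_RInt_le_const; [lra| |exact HB].
      apply (ex_RInt_continuous (V := R_CompleteNormedModule)).
      rewrite Rmin_left, Rmax_right by lra. exact Hc.
    + apply (ex_RInt_continuous (V := R_CompleteNormedModule)).
      rewrite Rmin_left, Rmax_right by lra. exact Hc.
Qed.

Lemma ball_between (s0 : R) (e : R) (a b x : R) :
  ball s0 e a -> ball s0 e b -> Rmin a b <= x <= Rmax a b -> ball s0 e x.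
Proof.
  intros Ha Hb Hx.
  change (Rabs (a - s0) < e) in Ha. change (Rabs (b - s0) < e) in Hb.
  change (Rabs (x - s0) < e).
  apply Rabs_def2 in Ha. apply Rabs_def2 in Hb.
  revert Hx. unfold Rmin, Rmax. destruct (Rle_dec a b); intros;
  apply Rabs_def1; lra.
Qed.

Section LipCalculus.

Context {V : NormedModule R_AbsRing}.
Implicit Types (f g : R -> V -> R) (X Y : V).

Lemma locally_pair_ball (z0 : R) (X0 : V) (P : R -> V -> Prop) :
  locally (z0, X0) (fun p => P (fst p) (snd p)) <->
  exists e : posreal, forall z X, ball z0 e z -> ball X0 e X -> P z X.
Proof.
  split; intros [e He]; exists e.
  - intros z X Hz HX. apply (He (z, X)). split; assumption.
  - intros [z X] [Hz HX]. apply He; assumption.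
Qed.

Lemma continuous_pair_near (z0 : R) (X0 : V) f (P : R -> Prop) :
  continuous (fun p : R * V => f (fst p) (snd p)) (z0, X0) ->
  locally (f z0 X0) P ->
  exists e : posreal, forall z X, ball z0 e z -> ball X0 e X -> P (f z X).
Proof.
  intros Hf HP.
  apply (locally_pair_ball z0 X0 (fun z X => P (f z X))).
  apply Hf, HP.
Qed.

Lemma lip_at_ext_loc (z0 : R) (X0 : V) f g :
  locally (z0, X0) (fun p => f (fst p) (snd p) = g (fst p) (snd p)) ->
  lip_at z0 X0 f -> lip_at z0 X0 g.
Proof.
  intros Heq [Hc [K [HK [e He]]]]. split.
  - apply (continuous_ext_loc _ _ _ Heq Hc).
  - apply (locally_pair_ball z0 X0 (fun z X => f z X = g z X)) in Heq.
    destruct Heq as [e' He'].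
    destruct (min_posreal e e') as [d [Hd Hd']].
    exists K; split; [exact HK|]. exists d. intros z X Y Hz HX HY.
    rewrite <- !He' by (eapply ball_le; eauto).
    apply He; eapply ball_le; eauto.
Qed.

Lemma lip_at_time (z0 : R) (X0 : V) (h : R -> R) :
  continuous h z0 -> lip_at z0 X0 (fun z _ => h z).
Proof.
  intros Hh. split.
  - apply (continuous_comp fst h); [apply continuous_fst | exact Hh].
  - exists 0; split; [lra|]. exists (mkposreal 1 Rlt_0_1). intros.
    rewrite Rminus_diag, Rabs_R0. lra.
Qed.

Lemma lip_at_const (z0 : R) (X0 : V) (k : R) : lip_at z0 X0 (fun _ _ => k).
Proof. apply (lip_at_time z0 X0 (fun _ => k)), continuous_const. Qed.

Lemma lip_at_plus (z0 : R) (X0 : V) f g :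
  lip_at z0 X0 f -> lip_at z0 X0 g -> lip_at z0 X0 (fun z X => f z X + g z X).
Proof.
  intros [Hfc [K [HK [e He]]]] [Hgc [L [HL [d Hd]]]]. split.
  - exact (continuous_plus _ _ _ Hfc Hgc).
  - exists (K + L); split; [lra|].
    destruct (min_posreal e d) as [m [Hm1 Hm2]].
    exists m. intros z X Y Hz HX HY.
    assert (H1 := He z X Y (ball_le _ _ _ Hm1 _ Hz) (ball_le _ _ _ Hm1 _ HX)
                    (ball_le _ _ _ Hm1 _ HY)).
    assert (H2 := Hd z X Y (ball_le _ _ _ Hm2 _ Hz) (ball_le _ _ _ Hm2 _ HX)
                    (ball_le _ _ _ Hm2 _ HY)).
    replace (f z X + g z X - (f z Y + g z Y))
      with ((f z X - f z Y) + (g z X - g z Y)) by ring.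
    eapply Rle_trans; [apply Rabs_triang|]. lra.
Qed.

Lemma continuous_bounded_near (z0 : R) (X0 : V) f :
  continuous (fun p : R * V => f (fst p) (snd p)) (z0, X0) ->
  exists B, 0 <= B /\ exists e : posreal, forall z X,
    ball z0 e z -> ball X0 e X -> Rabs (f z X) <= B.
Proof.
  intros Hf. exists (Rabs (f z0 X0) + 1).
  split; [assert (H := Rabs_pos (f z0 X0)); lra|].
  apply (continuous_pair_near z0 X0 f (fun y => Rabs y <= Rabs (f z0 X0) + 1)).
  - exact Hf.
  - exists (mkposreal 1 Rlt_0_1). intros y Hy.
    change (Rabs (y - f z0 X0) < 1) in Hy.
    assert (H := Rabs_triang_inv y (f z0 X0)). lra.
Qed.

Lemma lip_at_mult (z0 : R) (X0 : V) f g :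
  lip_at z0 X0 f -> lip_at z0 X0 g -> lip_at z0 X0 (fun z X => f z X * g z X).
Proof.
  intros [Hfc [K [HK [e He]]]] [Hgc [L [HL [d Hd]]]]. split.
  - exact (continuous_mult _ _ _ Hfc Hgc).
  - destruct (continuous_bounded_near _ _ _ Hfc) as [A [HA [ea Hea]]].
    destruct (continuous_bounded_near _ _ _ Hgc) as [B [HB [eb Heb]]].
    exists (A * L + K * B); split; [nra|].
    destruct (min_posreal e d) as [m [Hm1 Hm2]].
    destruct (min_posreal ea eb) as [n [Hn1 Hn2]].
    destruct (min_posreal m n) as [k [Hk1 Hk2]].
    exists k. intros z X Y Hz HX HY.
    assert (H1 : Rabs (f z X - f z Y) <= K * norm (minus X Y)).
    { apply He; (eapply ball_le; [|eassumption]); lra. }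
    assert (H2 : Rabs (g z X - g z Y) <= L * norm (minus X Y)).
    { apply Hd; (eapply ball_le; [|eassumption]); lra. }
    assert (H3 : Rabs (f z X) <= A).
    { apply Hea; (eapply ball_le; [|eassumption]); lra. }
    assert (H4 : Rabs (g z Y) <= B).
    { apply Heb; (eapply ball_le; [|eassumption]); lra. }
    replace (f z X * g z X - f z Y * g z Y)
      with (f z X * (g z X - g z Y) + (f z X - f z Y) * g z Y) by ring.
    eapply Rle_trans; [apply Rabs_triang|]. rewrite !Rabs_mult.
    assert (H5 := Rabs_pos (f z X)). assert (H6 := Rabs_pos (g z Y)).
    assert (H7 := Rabs_pos (g z X - g z Y)).
    assert (H8 := Rabs_pos (f z X - f z Y)).
    assert (Rabs (f z X) * Rabs (g z X - g z Y) <= A * (L * norm (minus X Y)))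
      by (apply Rmult_le_compat; assumption).
    assert (Rabs (f z X - f z Y) * Rabs (g z Y) <= (K * norm (minus X Y)) * B)
      by (apply Rmult_le_compat; assumption).
    lra.
Qed.

(** The outer function is C^1 near the base value, so it is Lipschitz there by
    the mean value inequality. *)
Lemma lip_at_comp (z0 : R) (X0 : V) (h h' : R -> R) f :
  locally (f z0 X0) (fun x => is_derive h x (h' x)) ->
  continuous h' (f z0 X0) ->
  lip_at z0 X0 f -> lip_at z0 X0 (fun z X => h (f z X)).
Proof.
  intros Hd Hc [Hfc [K [HK [e He]]]]. split.
  - apply (continuous_comp (fun p : R * V => f (fst p) (snd p)) h); [exact Hfc|].
    apply (ex_derive_continuous (K := R_AbsRing) (V := R_NormedModule)).
    exists (h' (f z0 X0)). exact (locally_singleton _ _ Hd).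
  - set (x0 := f z0 X0) in *.
    set (B := Rabs (h' x0) + 1).
    assert (HB : locally x0 (fun x => Rabs (h' x) <= B)).
    { apply (Hc (fun y => Rabs y <= B)). exists (mkposreal 1 Rlt_0_1). intros y Hy.
      change (Rabs (y - h' x0) < 1) in Hy.
      assert (H := Rabs_triang_inv y (h' x0)). unfold B. lra. }
    destruct (filter_and _ _ Hd HB) as [d Hdd].
    (* [bounded_variation] looks at a ball around f z Y of radius
       |f z X - f z Y|; a third of d keeps that ball inside the d-ball at x0 *)
    assert (Hd3 : 0 < d / 3) by (assert (H := cond_pos d); lra).
    assert (Hnear : locally x0 (ball x0 (mkposreal _ Hd3)))
      by apply locally_ball.
    destruct (continuous_pair_near z0 X0 f _ Hfc Hnear) as [e' He'].
    destruct (min_posreal e e') as [m [Hm1 Hm2]].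
    assert (HB0 : 0 <= B)
      by (unfold B; assert (H := Rabs_pos (h' x0)); lra).
    exists (B * K); split; [nra|].
    exists m. intros z X Y Hz HX HY.
    assert (H1 : Rabs (f z X - f z Y) <= K * norm (minus X Y)).
    { apply He; (eapply ball_le; [|eassumption]); lra. }
    assert (H2 : Rabs (f z X - x0) < d / 3).
    { apply He'; (eapply ball_le; [|eassumption]); lra. }
    assert (H3 : Rabs (f z Y - x0) < d / 3).
    { apply He'; (eapply ball_le; [|eassumption]); lra. }
    apply Rle_trans with (B * Rabs (f z X - f z Y)); [|nra].
    apply (bounded_variation h h'). intros t Ht. apply Hdd.
    change (Rabs (t - x0) < d).
    apply Rabs_def2 in H2. apply Rabs_def2 in H3.
    assert (Rabs (f z X - f z Y) < 2 * d / 3) by (apply Rabs_def1; lra).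
    assert (H5 : Rabs (t - f z Y) < 2 * d / 3) by lra.
    apply Rabs_def2 in H5. apply Rabs_def1; lra.
Qed.

Lemma lip_at_opp (z0 : R) (X0 : V) f :
  lip_at z0 X0 f -> lip_at z0 X0 (fun z X => - f z X).
Proof.
  intros Hf. apply lip_at_ext_loc with (fun z X => (-1) * f z X).
  - apply filter_forall. intros p. ring.
  - apply lip_at_mult; [apply lip_at_const | exact Hf].
Qed.

Lemma lip_at_minus (z0 : R) (X0 : V) f g :
  lip_at z0 X0 f -> lip_at z0 X0 g -> lip_at z0 X0 (fun z X => f z X - g z X).
Proof.
  intros Hf Hg. apply lip_at_plus; [exact Hf | apply lip_at_opp, Hg].
Qed.

Lemma lip_at_pow2 (z0 : R) (X0 : V) f :
  lip_at z0 X0 f -> lip_at z0 X0 (fun z X => f z X ^ 2).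
Proof.
  intros Hf. apply lip_at_ext_loc with (fun z X => f z X * f z X).
  - apply filter_forall. intros p. ring.
  - apply lip_at_mult; exact Hf.
Qed.

Lemma lip_at_inv (z0 : R) (X0 : V) f :
  f z0 X0 <> 0 -> lip_at z0 X0 f -> lip_at z0 X0 (fun z X => / f z X).
Proof.
  intros H0. apply (lip_at_comp z0 X0 Rinv (fun x => - 1 / x ^ 2)).
  - apply filter_imp with (fun x => x <> 0).
    + intros x Hx. apply (is_derive_inv (fun y => y)); [|exact Hx].
      apply (is_derive_id (K := R_AbsRing)).
    + apply (open_neq 0), H0.
  - apply (ex_derive_continuous (K := R_AbsRing) (V := R_NormedModule)).
    auto_derive. intros H. apply H0. nra.
Qed.

Lemma lip_at_div (z0 : R) (X0 : V) f g :
  g z0 X0 <> 0 -> lip_at z0 X0 f -> lip_at z0 X0 g ->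
  lip_at z0 X0 (fun z X => f z X / g z X).
Proof.
  intros H0 Hf Hg. apply lip_at_mult; [exact Hf|]. apply lip_at_inv; assumption.
Qed.

Lemma lip_at_sqrt (z0 : R) (X0 : V) f :
  0 < f z0 X0 -> lip_at z0 X0 f -> lip_at z0 X0 (fun z X => sqrt (f z X)).
Proof.
  intros H0. apply (lip_at_comp z0 X0 sqrt (fun x => 1 / (2 * sqrt x))).
  - apply filter_imp with (fun x => 0 < x).
    + intros x Hx. apply (is_derive_sqrt (fun y => y)); [|exact Hx].
      apply (is_derive_id (K := R_AbsRing)).
    + apply (open_gt 0), H0.
  - apply (ex_derive_continuous (K := R_AbsRing) (V := R_NormedModule)).
    auto_derive. assert (H := sqrt_lt_R0 _ H0). repeat split; lra.
Qed.

(** At the base point the two endpoints coincide, so nearby only values of phi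
    near (s0, X0) matter and the integration variable can take the place of z in
    the hypothesis on phi. The difference of the integrals at X and Y is that of
    phi(., X) over the two short intervals between corresponding endpoints, plus
    that of phi(., X) - phi(., Y) between the endpoints at Y; each is bounded by a
    multiple of the distance of X and Y. *)
Lemma lip_at_RInt (z0 s0 : R) (X0 : V) (phi : R -> V -> R) (a b : R -> V -> R) :
  a z0 X0 = s0 -> b z0 X0 = s0 ->
  locally (s0, X0) (fun p => continuous (fun x => phi x (snd p)) (fst p)) ->
  lip_at s0 X0 phi -> lip_at z0 X0 a -> lip_at z0 X0 b ->
  lip_at z0 X0 (fun z X => RInt (fun x => phi x X) (a z X) (b z X)).
Proof.
  intros Ha0 Hb0 Hcont [Hphic [K [HK [e He]]]]
    [Hac [Ka [HKa [ea Hea]]]] [Hbc [Kb [HKb [eb Heb]]]].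
  apply (locally_pair_ball s0 X0 (fun s X => continuous (fun x => phi x X) s))
    in Hcont.
  destruct Hcont as [ec Hec].
  destruct (continuous_bounded_near _ _ _ Hphic) as [B [HB [eB HeB]]].
  destruct (min_posreal ec eB) as [d1 [Hd1 Hd2]].
  destruct (min_posreal d1 e) as [d [Hd3 Hd4]].
  assert (Hla : locally (a z0 X0) (ball s0 d))
    by (rewrite Ha0; apply locally_ball).
  assert (Hlb : locally (b z0 X0) (ball s0 d))
    by (rewrite Hb0; apply locally_ball).
  destruct (continuous_pair_near z0 X0 a _ Hac Hla) as [da Hda].
  destruct (continuous_pair_near z0 X0 b _ Hbc Hlb) as [db Hdb].
  destruct (min_posreal da db) as [m1 [Hm1 Hm2]].
  destruct (min_posreal m1 d) as [m2 [Hm3 Hm4]].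
  assert (Hbnd : forall X u v, ball X0 m2 X -> ball s0 d u -> ball s0 d v ->
    Rabs (RInt (fun x => phi x X) u v) <= B * Rabs (v - u)).
  { intros X u v HX Hu Hv. apply Rabs_RInt_le; intros x Hx.
    - apply Hec.
      + apply (ball_le _ d); [lra|]. apply ball_between with u v; assumption.
      + apply (ball_le _ m2); [lra|exact HX].
    - apply HeB.
      + apply (ball_le _ d); [lra|]. apply ball_between with u v; assumption.
      + apply (ball_le _ m2); [lra|exact HX]. }
  assert (Hex : forall X u v, ball X0 m2 X -> ball s0 d u -> ball s0 d v ->
    ex_RInt (fun x => phi x X) u v).
  { intros X u v HX Hu Hv.
    apply (ex_RInt_continuous (V := R_CompleteNormedModule)). intros x Hx.
    apply Hec.
    - apply (ball_le _ d); [lra|]. apply ball_between with u v; assumption.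
    - apply (ball_le _ m2); [lra|exact HX]. }
  assert (Hia : forall z X, ball z0 m2 z -> ball X0 m2 X -> ball s0 d (a z X)).
  { intros z X Hz HX. apply Hda; (eapply ball_le; [|eassumption]); lra. }
  assert (Hib : forall z X, ball z0 m2 z -> ball X0 m2 X -> ball s0 d (b z X)).
  { intros z X Hz HX. apply Hdb; (eapply ball_le; [|eassumption]); lra. }
  split.
  - unfold continuous. simpl. rewrite Ha0, Hb0, RInt_point.
    apply filterlim_locally. intros eps.
    assert (Hepos : 0 < eps / (2 * (B + 1))).
    { apply Rdiv_lt_0_compat; [apply cond_pos | lra]. }
    set (eps' := mkposreal _ Hepos).
    assert (H1 : locally (a z0 X0) (ball s0 eps'))
      by (rewrite Ha0; apply locally_ball).
    assert (H2 : locally (b z0 X0) (ball s0 eps'))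
      by (rewrite Hb0; apply locally_ball).
    destruct (continuous_pair_near z0 X0 a _ Hac H1) as [n1 Hn1].
    destruct (continuous_pair_near z0 X0 b _ Hbc H2) as [n2 Hn2].
    destruct (min_posreal n1 n2) as [n3 [Hn3 Hn4]].
    destruct (min_posreal n3 m2) as [n [Hn5 Hn6]].
    exists n. intros [z X] [Hz HX]. simpl in Hz, HX |- *.
    change (Rabs (RInt (fun x => phi x X) (a z X) (b z X) - 0) < eps).
    rewrite Rminus_0_r.
    assert (G1 : Rabs (a z X - s0) < eps').
    { apply Hn1; (eapply ball_le; [|eassumption]); lra. }
    assert (G2 : Rabs (b z X - s0) < eps').
    { apply Hn2; (eapply ball_le; [|eassumption]); lra. }
    assert (G3 : Rabs (b z X - a z X) < 2 * eps').
    { apply Rabs_def2 in G1. apply Rabs_def2 in G2. apply Rabs_def1; lra. }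
    assert (Hz' := ball_le _ _ _ Hn6 _ Hz). assert (HX' := ball_le _ _ _ Hn6 _ HX).
    eapply Rle_lt_trans; [apply Hbnd; auto|].
    assert (G4 : (B + 1) * (2 * eps') = eps) by (simpl; field; lra).
    assert (G5 := Rabs_pos (b z X - a z X)). nra.
  - exists (B * Ka + K * (2 * d) + B * Kb).
    assert (Hdpos := cond_pos d).
    split; [assert (0 <= B * Ka) by nra; assert (0 <= K * (2 * d)) by nra;
            assert (0 <= B * Kb) by nra; lra|].
    destruct (min_posreal ea eb) as [n1 [Hn1 Hn2]].
    destruct (min_posreal n1 m2) as [n [Hn3 Hn4]].
    exists n. intros z X Y Hz HX HY.
    assert (La : Rabs (a z X - a z Y) <= Ka * norm (minus X Y)).
    { apply Hea; (eapply ball_le; [|eassumption]); lra. }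
    assert (Lb : Rabs (b z X - b z Y) <= Kb * norm (minus X Y)).
    { apply Heb; (eapply ball_le; [|eassumption]); lra. }
    assert (Hz' := ball_le _ _ _ Hn4 _ Hz). assert (HX' := ball_le _ _ _ Hn4 _ HX).
    assert (HY' := ball_le _ _ _ Hn4 _ HY).
    assert (G1 := Hia z X Hz' HX'). assert (G2 := Hia z Y Hz' HY').
    assert (G3 := Hib z X Hz' HX'). assert (G4 := Hib z Y Hz' HY').
    assert (Hsplit : RInt (fun x => phi x X) (a z X) (b z X)
      = RInt (fun x => phi x X) (a z X) (a z Y)
        + RInt (fun x => phi x X) (a z Y) (b z Y)
        + RInt (fun x => phi x X) (b z Y) (b z X)).
    { rewrite <- (RInt_Chasles (V := R_CompleteNormedModule)
        (fun x => phi x X) (a z X) (b z Y) (b z X)) by auto.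
      rewrite <- (RInt_Chasles (V := R_CompleteNormedModule)
        (fun x => phi x X) (a z X) (a z Y) (b z Y)) by auto.
      reflexivity. }
    assert (Hdiff : RInt (fun x => phi x X) (a z Y) (b z Y)
      - RInt (fun x => phi x Y) (a z Y) (b z Y)
      = RInt (fun x => phi x X - phi x Y) (a z Y) (b z Y)).
    { symmetry. apply (RInt_minus (V := R_CompleteNormedModule)
        (fun x => phi x X) (fun x => phi x Y)); auto. }
    assert (T1 := Hbnd X _ _ HX' G1 G2). assert (T3 := Hbnd X _ _ HX' G4 G3).
    rewrite Rabs_minus_sym in La.
    assert (T2 : Rabs (RInt (fun x => phi x X - phi x Y) (a z Y) (b z Y))
      <= K * norm (minus X Y) * Rabs (b z Y - a z Y)).
    { apply Rabs_RInt_le; intros x Hx;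
      assert (Hxb := ball_between s0 d _ _ x G2 G4 Hx).
      - apply (continuous_minus (V := R_NormedModule)
                 (fun x => phi x X) (fun x => phi x Y));
        apply Hec; (eapply ball_le; [|eassumption]); lra.
      - apply He; (eapply ball_le; [|eassumption]); lra. }
    assert (T4 : Rabs (b z Y - a z Y) <= 2 * d).
    { change (Rabs (a z Y - s0) < d) in G2. change (Rabs (b z Y - s0) < d) in G4.
      apply Rabs_def2 in G2. apply Rabs_def2 in G4.
      apply Rlt_le, Rabs_def1; lra. }
    rewrite Hsplit.
    match goal with |- Rabs (?p + ?q + ?r - ?s) <= _ =>
      replace (p + q + r - s) with (p + (q - s) + r) by ring end.
    rewrite Hdiff.
    eapply Rle_trans; [apply Rabs_triang|].
    eapply Rle_trans; [apply Rplus_le_compat_r, Rabs_triang|].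
    assert (N : 0 <= norm (minus X Y)) by apply norm_ge_0.
    assert (N2 : 0 <= K * norm (minus X Y)) by nra.
    assert (U1 : B * Rabs (a z Y - a z X) <= B * (Ka * norm (minus X Y)))
      by (apply Rmult_le_compat_l; assumption).
    assert (U3 : B * Rabs (b z X - b z Y) <= B * (Kb * norm (minus X Y)))
      by (apply Rmult_le_compat_l; assumption).
    assert (U2 : K * norm (minus X Y) * Rabs (b z Y - a z Y)
      <= K * norm (minus X Y) * (2 * d))
      by (apply Rmult_le_compat_l; assumption).
    lra.
Qed.

End LipCalculus.

(** * Uniqueness for a system of three equations *)

(** [auto_derive] leaves the derivative of an unknown function in eta-expanded
    form, which [is_derive_unique] does not match when rewriting. *)
Lemma Derive_eta (f : R -> R) (x l : R) :
  is_derive f x l -> Derive (fun y => f y) x = l.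
Proof. exact (is_derive_unique f x l). Qed.

(** With s the sign of z - z0, the function w exp(-sK(x - z0)) is monotone in
    the direction that makes it non-positive at z. *)
Lemma gronwall_zero (w dw : R -> R) (K z0 e : R) :
  (forall z, Rabs (z - z0) < e ->
     is_derive w z (dw z) /\ Rabs (dw z) <= K * w z) ->
  (forall z, 0 <= w z) -> w z0 = 0 ->
  forall z, Rabs (z - z0) < e -> w z = 0.
Proof.
  intros Hw Hpos H0 z Hz.
  assert (Hs : exists s, (s = 1 \/ s = -1) /\ 0 <= s * (z - z0)).
  { destruct (Rle_or_lt z0 z); [exists 1 | exists (-1)]; split; lra. }
  destruct Hs as [s [Hs1 Hsz]].
  set (p := fun x => w x * exp (- (s * K) * (x - z0))).
  set (dp := fun x => (dw x - s * K * w x) * exp (- (s * K) * (x - z0))).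
  assert (Hin : forall x, Rmin z0 z <= x <= Rmax z0 z -> Rabs (x - z0) < e).
  { intros x Hx. apply Rabs_def2 in Hz. revert Hx.
    unfold Rmin, Rmax. destruct (Rle_dec z0 z); intros; apply Rabs_def1; lra. }
  assert (Hdp : forall x, Rmin z0 z <= x <= Rmax z0 z -> is_derive p x (dp x)).
  { intros x Hx. destruct (Hw x (Hin x Hx)) as [Hd _].
    unfold p, dp. auto_derive.
    - exists (dw x). exact Hd.
    - rewrite (Derive_eta _ _ _ Hd). unfold Rminus. ring. }
  destruct (MVT_gen p z0 z dp) as [x [Hx Heq]].
  - intros x Hx. apply Hdp. lra.
  - intros x Hx. apply continuity_pt_filterlim.
    apply (ex_derive_continuous (K := R_AbsRing) (V := R_NormedModule)).
    exists (dp x). apply Hdp, Hx.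
  - destruct (Hw x (Hin x Hx)) as [_ Hb].
    assert (Hsgn : s * dp x <= 0).
    { unfold dp. rewrite <- Rmult_assoc.
      assert (He := exp_pos (- (s * K) * (x - z0))).
      assert (s * (dw x - s * K * w x) <= 0); [|nra].
      apply Rabs_le_between in Hb. destruct Hs1 as [-> | ->]; lra. }
    assert (Hp : p z - p z0 <= 0).
    { rewrite Heq. destruct Hs1 as [-> | ->]; nra. }
    unfold p in Hp. rewrite H0 in Hp.
    assert (He := exp_pos (- (s * K) * (z - z0))).
    specialize (Hpos z). nra.
Qed.

(** The points (r, t, M). The norm is Euclidean, so that the squared distance of
    two solutions is a polynomial in their components and can be differentiated. *)
Definition state : NormedModule R_AbsRing :=
  prod_NormedModule R_AbsRing
    (prod_NormedModule R_AbsRing R_NormedModule R_NormedModule) R_NormedModule.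

Definition rad (X : state) : R := fst (fst X).
Definition tim (X : state) : R := snd (fst X).
Definition mas (X : state) : R := snd X.

Lemma norm_state_minus (X Y : state) :
  norm (minus X Y)
  = sqrt ((rad X - rad Y) ^ 2 + (tim X - tim Y) ^ 2 + (mas X - mas Y) ^ 2).
Proof.
  destruct X as [[r t] m], Y as [[r' t'] m'].
  unfold rad, tim, mas; simpl fst; simpl snd.
  change (norm (minus (r, t, m) (r', t', m')))
    with (sqrt (sqrt (Rabs (r + - r') ^ 2 + Rabs (t + - t') ^ 2) ^ 2
                + Rabs (m + - m') ^ 2)).
  rewrite pow2_sqrt by (assert (H := pow2_ge_0 (Rabs (r + - r')));
                        assert (H' := pow2_ge_0 (Rabs (t + - t'))); lra).
  rewrite !pow2_abs. reflexivity.
Qed.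

Lemma coordinate_le_norm (X Y : state) :
  Rabs (rad X - rad Y) <= norm (minus X Y) /\
  Rabs (tim X - tim Y) <= norm (minus X Y) /\
  Rabs (mas X - mas Y) <= norm (minus X Y).
Proof.
  rewrite norm_state_minus.
  assert (H1 := pow2_ge_0 (rad X - rad Y)).
  assert (H2 := pow2_ge_0 (tim X - tim Y)).
  assert (H3 := pow2_ge_0 (mas X - mas Y)).
  repeat split; rewrite <- sqrt_Rsqr_abs; apply sqrt_le_1_alt; unfold Rsqr; lra.
Qed.

Lemma lip_at_coordinate (z0 : R) (X0 : state) (u : state -> R) :
  (forall X Y, Rabs (u X - u Y) <= norm (minus X Y)) ->
  lip_at z0 X0 (fun _ X => u X).
Proof.
  intros Hu. split.
  - apply (continuous_comp snd u); [destruct X0; apply continuous_snd|].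
    apply filterlim_locally. intros eps. simpl.
    apply (locally_le_locally_norm (V := state)).
    exists eps. intros Y HY. change (Rabs (u Y - u X0) < eps).
    eapply Rle_lt_trans; [apply Hu | exact HY].
  - exists 1; split; [lra|]. exists (mkposreal 1 Rlt_0_1).
    intros z X Y _ _ _. rewrite Rmult_1_l. apply Hu.
Qed.

Lemma lip_at_rad (z0 : R) (X0 : state) : lip_at z0 X0 (fun _ X => rad X).
Proof. apply lip_at_coordinate. intros X Y. apply coordinate_le_norm. Qed.

Lemma lip_at_mas (z0 : R) (X0 : state) : lip_at z0 X0 (fun _ X => mas X).
Proof. apply lip_at_coordinate. intros X Y. apply coordinate_le_norm. Qed.

Definition solves (f g h : R -> state -> R) (r t m : R -> R) (z : R) : Prop :=
  is_derive r z (f z (r z, t z, m z)) /\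
  is_derive t z (g z (r z, t z, m z)) /\
  is_derive m z (h z (r z, t z, m z)).

Lemma solves_near (f g h : R -> state -> R) (r t m : R -> R) (z0 : R)
    (e : posreal) :
  solves f g h r t m z0 ->
  locally z0 (fun z => ball ((r z0, t z0, m z0) : state) e ((r z, t z, m z) : state)).
Proof.
  intros [Hr [Ht Hm]].
  assert (Hc : forall (u : R -> R) (l : R), is_derive u z0 l ->
    locally z0 (fun z => ball (u z0) e (u z))).
  { intros u l Hu.
    assert (C : continuous u z0).
    { apply (ex_derive_continuous (K := R_AbsRing) (V := R_NormedModule)).
      exists l. exact Hu. }
    apply (C (ball (u z0) e)). apply locally_ball. }
  apply Hc in Hr. apply Hc in Ht. apply Hc in Hm.
  generalize (filter_and _ _ Hr (filter_and _ _ Ht Hm)). apply filter_imp.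
  intros z [H1 [H2 H3]]. split; [split|]; assumption.
Qed.

(** The squared distance w of the two solutions satisfies |w'| <= 2Kw with K the
    sum of the three Lipschitz constants: each component of a difference is at
    most its norm. *)
Theorem ode_unique (z0 : R) (X0 : state) (f g h : R -> state -> R)
    (r1 t1 m1 r2 t2 m2 : R -> R) :
  lip_at z0 X0 f -> lip_at z0 X0 g -> lip_at z0 X0 h ->
  locally z0 (solves f g h r1 t1 m1) -> locally z0 (solves f g h r2 t2 m2) ->
  (r1 z0, t1 z0, m1 z0) = X0 -> (r2 z0, t2 z0, m2 z0) = X0 ->
  locally z0 (fun z => r1 z = r2 z /\ t1 z = t2 z /\ m1 z = m2 z).
Proof.
  intros [_ [Kf [HKf [ef Hf]]]] [_ [Kg [HKg [eg Hg]]]] [_ [Kh [HKh [eh Hh]]]]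
    S1 S2 I1 I2.
  destruct (min_posreal ef eg) as [e1 [He1 He2]].
  destruct (min_posreal e1 eh) as [e [He3 He4]].
  assert (N1 := solves_near _ _ _ _ _ _ _ e (locally_singleton _ _ S1)).
  assert (N2 := solves_near _ _ _ _ _ _ _ e (locally_singleton _ _ S2)).
  rewrite I1 in N1. rewrite I2 in N2.
  destruct (filter_and _ _ (filter_and _ _ S1 S2)
    (filter_and _ _ (filter_and _ _ N1 N2) (locally_ball z0 e))) as [d Hd].
  set (w := fun z => (r1 z - r2 z) ^ 2 + (t1 z - t2 z) ^ 2 + (m1 z - m2 z) ^ 2).
  set (F := fun k : R -> state -> R => fun z =>
    k z (r1 z, t1 z, m1 z) - k z (r2 z, t2 z, m2 z)).
  set (dw := fun z => 2 * (r1 z - r2 z) * F f z + 2 * (t1 z - t2 z) * F g z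
                      + 2 * (m1 z - m2 z) * F h z).
  assert (Hwpos : forall z, 0 <= w z).
  { intros z. unfold w. assert (H1 := pow2_ge_0 (r1 z - r2 z)).
    assert (H2 := pow2_ge_0 (t1 z - t2 z)).
    assert (H3 := pow2_ge_0 (m1 z - m2 z)). lra. }
  assert (Hw0 : w z0 = 0).
  { rewrite <- I2 in I1. injection I1 as E1 E2 E3. unfold w.
    rewrite E1, E2, E3. ring. }
  assert (Hw : forall z, Rabs (z - z0) < d ->
    is_derive w z (dw z) /\ Rabs (dw z) <= 2 * (Kf + Kg + Kh) * w z).
  { intros z Hz. destruct (Hd z Hz) as [[A1 A2] [[B1 B2] B3]]. clear Hz. split.
    - destruct A1 as [P1 [P2 P3]], A2 as [Q1 [Q2 Q3]].
      unfold w, dw, F. auto_derive.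
      + repeat split; eexists; eassumption.
      + rewrite (Derive_eta _ _ _ P1), (Derive_eta _ _ _ P2),
          (Derive_eta _ _ _ P3), (Derive_eta _ _ _ Q1),
          (Derive_eta _ _ _ Q2), (Derive_eta _ _ _ Q3). ring.
    - set (X := (r1 z, t1 z, m1 z) : state) in *.
      set (Y := (r2 z, t2 z, m2 z) : state) in *.
      destruct (coordinate_le_norm X Y) as [C1 [C2 C3]].
      assert (Hn : norm (minus X Y) * norm (minus X Y) = w z).
      { rewrite norm_state_minus. apply sqrt_sqrt. apply (Hwpos z). }
      assert (L1 : Rabs (f z X - f z Y) <= Kf * norm (minus X Y)).
      { apply Hf; (eapply ball_le; [|eassumption]); lra. }
      assert (L2 : Rabs (g z X - g z Y) <= Kg * norm (minus X Y)).
      { apply Hg; (eapply ball_le; [|eassumption]); lra. }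
      assert (L3 : Rabs (h z X - h z Y) <= Kh * norm (minus X Y)).
      { apply Hh; (eapply ball_le; [|eassumption]); lra. }
      assert (Hprod : forall u k K, Rabs u <= norm (minus X Y) ->
        Rabs k <= K * norm (minus X Y) -> Rabs (2 * u * k) <= 2 * K * w z).
      { intros u k K Hu Hk. rewrite <- Hn, !Rabs_mult, (Rabs_right 2) by lra.
        assert (H := Rmult_le_compat _ _ _ _ (Rabs_pos u) (Rabs_pos k) Hu Hk).
        lra. }
      unfold dw.
      eapply Rle_trans; [apply Rabs_triang|].
      eapply Rle_trans; [apply Rplus_le_compat_r, Rabs_triang|].
      assert (T1 := Hprod _ _ _ C1 L1). assert (T2 := Hprod _ _ _ C2 L2).
      assert (T3 := Hprod _ _ _ C3 L3).
      change (Rabs (2 * (r1 z - r2 z) * F f z) <= 2 * Kf * w z) in T1.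
      change (Rabs (2 * (t1 z - t2 z) * F g z) <= 2 * Kg * w z) in T2.
      change (Rabs (2 * (m1 z - m2 z) * F h z) <= 2 * Kh * w z) in T3.
      lra. }
  exists d. intros z Hz.
  assert (Hwz := gronwall_zero w dw _ z0 d Hw Hwpos Hw0 z Hz).
  unfold w in Hwz.
  assert (P1 := pow2_ge_0 (r1 z - r2 z)). assert (P2 := pow2_ge_0 (t1 z - t2 z)).
  assert (P3 := pow2_ge_0 (m1 z - m2 z)).
  repeat split; apply Rminus_diag_uniq, Rsqr_0_uniq; unfold Rsqr; lra.
Qed.

(** * Differentiation under the integral sign *)

(** The derivative of sqrt(x / (a(x) u + b(x))) with respect to u. Taking
    a = 1, b = xE and u = M, or a = x, b = M and u = E, gives the two parameter
    derivatives of the integrand of J, which are thus treated together. *)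
Definition param_slope (a b : R -> R) (u x : R) : R :=
  - (x * a x / (a x * u + b x) ^ 2) / (2 * sqrt (x / (a x * u + b x))).

Section ParamIntegral.

Variables (a b : R -> R).
Hypothesis (Ha : forall x, 0 < x -> 0 < a x).
Hypothesis (Hb : forall x, 0 < x -> 0 < b x).
Hypothesis (Hac : forall x, continuous a x).
Hypothesis (Hbc : forall x, continuous b x).

Lemma param_denom_pos (u x : R) : 0 < u -> 0 < x -> 0 < a x * u + b x.
Proof. intros Hu Hx. specialize (Ha x Hx). specialize (Hb x Hx). nra. Qed.

Lemma is_derive_param_integrand (u x : R) :
  0 < u -> 0 < x ->
  is_derive (fun v => sqrt (x / (a x * v + b x))) u (param_slope a b u x).
Proof.
  intros Hu Hx. assert (HD := param_denom_pos u x Hu Hx).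
  assert (Hq : 0 < x / (a x * u + b x)) by (apply Rdiv_lt_0_compat; assumption).
  assert (Hs := sqrt_lt_R0 _ Hq).
  unfold param_slope. auto_derive.
  - repeat split; [lra | exact Hq].
  - fold (x / (a x * u + b x)).
    set (s := sqrt (x / (a x * u + b x))) in *. field. split; lra.
Qed.

Lemma continuous_param_denom (p : R * R) :
  continuous (fun p : R * R => a (snd p) * fst p + b (snd p)) p.
Proof.
  destruct p as [u x].
  assert (C1 : continuous (fun p : R * R => a (snd p)) (u, x)).
  { apply (continuous_comp snd a); [apply continuous_snd | apply Hac]. }
  assert (C2 : continuous (fun p : R * R => b (snd p)) (u, x)).
  { apply (continuous_comp snd b); [apply continuous_snd | apply Hbc]. }
  exact (continuous_plus _ _ _
    (continuous_mult (K := R_AbsRing) _ _ _ C1 (continuous_fst u x)) C2).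
Qed.

Lemma continuous_param_slope (u x : R) :
  0 < u -> 0 < x ->
  continuous (fun p : R * R => param_slope a b (fst p) (snd p)) (u, x).
Proof.
  intros Hu Hx. assert (HD := param_denom_pos u x Hu Hx).
  assert (Hq : 0 < x / (a x * u + b x)) by (apply Rdiv_lt_0_compat; assumption).
  assert (Hs := sqrt_lt_R0 _ Hq).
  assert (C1 : continuous (fun p : R * R => a (snd p)) (u, x)).
  { apply (continuous_comp snd a); [apply continuous_snd | apply Hac]. }
  assert (CD := continuous_param_denom (u, x)).
  assert (Cx : continuous (fun p : R * R => snd p) (u, x)) by apply continuous_snd.
  assert (Cinv : forall k : R * R -> R, continuous k (u, x) -> k (u, x) <> 0 ->
    continuous (fun p => / k p) (u, x)).
  { intros k Hk H0. apply (continuous_comp k Rinv); [exact Hk|].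
    apply continuous_Rinv, H0. }
  assert (CDi : continuous (fun p : R * R => / (a (snd p) * fst p + b (snd p))) (u, x)).
  { apply Cinv; [exact CD | simpl; lra]. }
  assert (CDi2 : continuous (fun p : R * R => / (a (snd p) * fst p + b (snd p)) ^ 2)
            (u, x)).
  { apply Cinv; [|simpl; nra].
    apply continuous_ext with (fun p : R * R =>
      (a (snd p) * fst p + b (snd p)) * (a (snd p) * fst p + b (snd p))).
    - intros p. simpl. ring.
    - exact (continuous_mult (K := R_AbsRing) _ _ _ CD CD). }
  assert (Cq : continuous (fun p : R * R =>
            snd p / (a (snd p) * fst p + b (snd p))) (u, x)).
  { exact (continuous_mult (K := R_AbsRing) _ _ _ Cx CDi). }
  assert (Csq : continuous (fun p : R * R =>
            sqrt (snd p / (a (snd p) * fst p + b (snd p)))) (u, x)).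
  { apply (continuous_comp _ sqrt); [exact Cq | apply continuous_sqrt]. }
  unfold param_slope.
  apply (continuous_mult (K := R_AbsRing)).
  - apply (continuous_opp (V := R_NormedModule)).
    apply (continuous_mult (K := R_AbsRing)); [|exact CDi2].
    apply (continuous_mult (K := R_AbsRing)); [exact Cx | exact C1].
  - apply Cinv; [|simpl; lra].
    apply (continuous_mult (K := R_AbsRing)); [apply continuous_const | exact Csq].
Qed.

Lemma continuous_param_slope_r (u x : R) :
  0 < u -> 0 < x -> continuous (param_slope a b u) x.
Proof.
  intros Hu Hx.
  apply (continuous_comp_2 (fun _ => u) (fun y => y) (param_slope a b)).
  - apply continuous_const.
  - apply continuous_id.
  - apply continuous_param_slope; assumption.
Qed.

Lemma continuous_param_integrand (u x : R) :
  0 < u -> 0 < x -> continuous (fun x => sqrt (x / (a x * u + b x))) x.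
Proof.
  intros Hu Hx. assert (HD := param_denom_pos u x Hu Hx).
  apply continuous_sqrt_comp.
  apply (continuous_mult (K := R_AbsRing)); [apply continuous_id|].
  apply continuous_Rinv_comp; [|simpl; lra].
  apply (continuous_plus (V := R_NormedModule)); [|apply Hbc].
  apply (continuous_mult (K := R_AbsRing)); [apply Hac | apply continuous_const].
Qed.

Lemma is_derive_param_RInt (u p q : R) :
  0 < u -> 0 < p -> 0 < q ->
  is_derive (fun v => RInt (fun x => sqrt (x / (a x * v + b x))) p q) u
    (RInt (param_slope a b u) p q).
Proof.
  intros Hu Hp Hq.
  assert (Hpos : forall x, Rmin p q <= x <= Rmax p q -> 0 < x).
  { intros x [Hx _]. eapply Rlt_le_trans; [|exact Hx]. apply Rmin_glb_lt; assumption. }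
  assert (Hloc : locally u (fun v => 0 < v)) by (apply (open_gt 0), Hu).
  rewrite (RInt_ext (V := R_CompleteNormedModule) (param_slope a b u)
    (fun x => Derive (fun v => sqrt (x / (a x * v + b x))) u)).
  2: { intros x Hx. symmetry. apply is_derive_unique, is_derive_param_integrand;
       [exact Hu | apply Hpos; lra]. }
  apply (is_derive_RInt_param (fun v x => sqrt (x / (a x * v + b x)))).
  - revert Hloc. apply filter_imp. intros v Hv x Hx.
    exists (param_slope a b v x). apply is_derive_param_integrand; auto.
  - intros x Hx. assert (Hx0 := Hpos x Hx).
    apply continuity_2d_pt_ext_loc with (param_slope a b).
    + apply locally_2d_locally.
      assert (L1 : locally (u, x) (fun p : R * R => 0 < fst p)).
      { apply (continuous_fst u x (fun y => 0 < y)), Hloc. }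
      assert (L2 : locally (u, x) (fun p : R * R => 0 < snd p)).
      { apply (continuous_snd u x (fun y => 0 < y)). apply (open_gt 0), Hx0. }
      generalize (filter_and _ _ L1 L2). apply filter_imp.
      intros [v y] [Hv Hy]. simpl in *. symmetry.
      apply is_derive_unique, is_derive_param_integrand; assumption.
    + apply continuity_2d_pt_filterlim.
      exact (continuous_param_slope u x Hu Hx0).
  - revert Hloc. apply filter_imp. intros v Hv.
    apply (ex_RInt_continuous (V := R_CompleteNormedModule)). intros x Hx.
    apply continuous_param_integrand; auto.
Qed.

End ParamIntegral.

(** * The partial derivatives of J *)

Lemma Derive_affine_minus (I : R -> R) (k x l : R) :
  is_derive I x l -> Derive (fun y => k - sigma * I y) x = - l.
Proof.
  intros HI. apply is_derive_unique. unfold sigma. auto_derive.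
  - exists l. exact HI.
  - rewrite (Derive_eta _ _ _ HI). ring.
Qed.

Section DerivativesOfJ.

Variables (c Rv R0 M E t : R).
Hypotheses (HRv : 0 < Rv) (HR0 : 0 < R0) (HM : 0 < M) (HE : 0 < E).

Let integrand (tau : R) : R := sqrt (tau / (tau * E + M)).

Lemma continuous_J_integrand (x : R) : 0 < x -> continuous integrand x.
Proof.
  intros Hx.
  apply (continuous_param_integrand (fun x => x) (fun _ => M)) with (u := E);
    try assumption; intros; auto using continuous_id, continuous_const.
Qed.

Lemma is_RInt_J_integrand (p q : R) :
  0 < p -> 0 < q -> is_RInt integrand p q (RInt integrand p q).
Proof.
  intros Hp Hq. apply (RInt_correct (V := R_CompleteNormedModule)).
  apply (ex_RInt_continuous (V := R_CompleteNormedModule)). intros x [Hx _].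
  apply continuous_J_integrand.
  eapply Rlt_le_trans; [|exact Hx]. apply Rmin_glb_lt; assumption.
Qed.

Lemma dJ_R_eq : dJ_R c Rv R0 M E t = - sqrt (Rv / (Rv * E + M)).
Proof.
  apply (Derive_affine_minus (fun y => RInt integrand R0 y)).
  apply (is_derive_RInt integrand) with R0.
  - apply filter_imp with (fun y => 0 < y); [|apply (open_gt 0), HRv].
    intros y Hy. apply is_RInt_J_integrand; assumption.
  - apply continuous_J_integrand, HRv.
Qed.

Lemma dJ_R0_eq : dJ_R0 c Rv R0 M E t = sqrt (R0 / (R0 * E + M)).
Proof.
  rewrite <- (Ropp_involutive (sqrt _)).
  apply (Derive_affine_minus (fun y => RInt integrand y Rv)).
  apply (is_derive_RInt' integrand) with Rv.
  - apply filter_imp with (fun y => 0 < y); [|apply (open_gt 0), HR0].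
    intros y Hy. apply is_RInt_J_integrand; assumption.
  - apply continuous_J_integrand, HR0.
Qed.

Lemma dJ_E_eq :
  dJ_E c Rv R0 M E t = - RInt (param_slope (fun x => x) (fun _ => M) E) R0 Rv.
Proof.
  apply (Derive_affine_minus
    (fun v => RInt (fun x => sqrt (x / (x * v + M))) R0 Rv)).
  apply (is_derive_param_RInt (fun x => x) (fun _ => M)); try assumption;
    intros; auto using continuous_id, continuous_const.
Qed.

Lemma dJ_M_eq :
  dJ_M c Rv R0 M E t
  = - RInt (param_slope (fun _ => 1) (fun x => x * E) M) R0 Rv.
Proof.
  unfold dJ_M, J.
  rewrite (Derive_ext _ (fun v => sqrt 2 * (t - t0 c)
    - sigma * RInt (fun x => sqrt (x / (1 * v + x * E))) R0 Rv)).
  2: { intros v. do 2 f_equal. apply (RInt_ext (V := R_CompleteNormedModule)).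
       intros x _. do 2 f_equal. ring. }
  apply (Derive_affine_minus
    (fun v => RInt (fun x => sqrt (x / (1 * v + x * E))) R0 Rv)).
  apply (is_derive_param_RInt (fun _ => 1) (fun x => x * E)); try assumption.
  - intros; lra.
  - intros; nra.
  - intros; apply continuous_const.
  - intros. apply (continuous_mult (K := R_AbsRing));
      [apply continuous_id | apply continuous_const].
Qed.

End DerivativesOfJ.

(** * The areal radius along the light cone *)

Section Areal.

Variable OL : R.
Hypothesis hOL : 0 <= OL <= 1.

Lemma calI_radicand_pos (y : R) : 0 < y -> 0 < OL + (1 - OL) * y ^ 3.
Proof.
  intros Hy. assert (H := pow_lt y 3 Hy).
  destruct (Rle_or_lt OL (1 / 2)); nra.
Qed.

Lemma calI_pos (y : R) : 0 < y -> 0 < calI OL y.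
Proof.
  intros Hy. apply Rdiv_lt_0_compat; [lra|].
  apply sqrt_lt_R0, calI_radicand_pos, Hy.
Qed.

Lemma continuous_calI (y : R) : 0 < y -> continuous (calI OL) y.
Proof.
  intros Hy. assert (H := calI_radicand_pos y Hy).
  apply (ex_derive_continuous (K := R_AbsRing) (V := R_NormedModule)).
  unfold calI. auto_derive. assert (Hs := sqrt_lt_R0 _ H).
  simpl in H, Hs. repeat split; lra.
Qed.

Lemma ex_RInt_calI (y : R) : 0 < y -> ex_RInt (calI OL) 1 y.
Proof.
  intros Hy. apply (ex_RInt_continuous (V := R_CompleteNormedModule)).
  intros x [Hx _]. apply continuous_calI.
  eapply Rlt_le_trans; [|exact Hx]. apply Rmin_glb_lt; lra.
Qed.

Lemma Rof_pos (z : R) : 0 < z -> 0 < Rof OL z.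
Proof.
  intros Hz. unfold Rof. apply Rmult_lt_0_compat.
  - apply Rdiv_lt_0_compat; lra.
  - apply RInt_gt_0; [lra| |].
    + intros x Hx. apply calI_pos; lra.
    + intros x Hx. apply continuous_calI; lra.
Qed.

Definition Rof_slope (z : R) : R :=
  - (1 / (1 + z) ^ 2) * RInt (calI OL) 1 (1 + z) + 1 / (1 + z) * calI OL (1 + z).

Lemma is_derive_RInt_calI (z : R) :
  0 < z -> is_derive (fun x => RInt (calI OL) 1 (1 + x)) z (calI OL (1 + z)).
Proof.
  intros Hz.
  replace (calI OL (1 + z)) with (scal 1 (calI OL (1 + z)))
    by apply (scal_one (K := R_AbsRing)).
  apply (is_derive_comp (RInt (calI OL) 1) (fun x => 1 + x)).
  - apply (is_derive_RInt (calI OL)) with 1.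
    + apply filter_imp with (fun y => 0 < y); [|apply (open_gt 0); lra].
      intros y Hy. apply (RInt_correct (V := R_CompleteNormedModule)).
      apply ex_RInt_calI, Hy.
    + apply continuous_calI; lra.
  - auto_derive; [exact I | ring].
Qed.

Lemma is_derive_Rof (z : R) : 0 < z -> is_derive (Rof OL) z (Rof_slope z).
Proof.
  intros Hz. assert (H := is_derive_RInt_calI z Hz).
  unfold Rof, Rof_slope.
  set (P := fun x : R => RInt (calI OL) 1 (1 + x) : R).
  change (is_derive P z (calI OL (1 + z))) in H.
  change (is_derive (fun x => 1 / (1 + x) * P x) z
    (- (1 / (1 + z) ^ 2) * P z + 1 / (1 + z) * calI OL (1 + z))).
  clearbody P. auto_derive.
  - repeat split; [lra | eexists; exact H].
  - rewrite (Derive_eta _ _ _ H). field. lra.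
Qed.

Lemma continuous_Rof (z : R) : 0 < z -> continuous (Rof OL) z.
Proof.
  intros Hz. apply (ex_derive_continuous (K := R_AbsRing) (V := R_NormedModule)).
  exists (Rof_slope z). apply is_derive_Rof, Hz.
Qed.

Lemma continuous_R_z (z : R) : 0 < z -> continuous (R_z OL) z.
Proof.
  intros Hz. apply continuous_ext_loc with Rof_slope.
  - apply filter_imp with (fun y => 0 < y); [|apply (open_gt 0), Hz].
    intros y Hy. symmetry. apply is_derive_unique, is_derive_Rof, Hy.
  - assert (C : forall k : R -> R, ex_derive k z -> continuous k z)
      by (intros; apply (ex_derive_continuous (K := R_AbsRing)
                           (V := R_NormedModule)); assumption).
    apply (continuous_plus (V := R_NormedModule));
    apply (continuous_mult (K := R_AbsRing)).
    + apply C. auto_derive. nra.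
    + apply C. eexists. apply is_derive_RInt_calI, Hz.
    + apply C. auto_derive. lra.
    + apply (continuous_comp (fun x => 1 + x) (calI OL)).
      * apply C. auto_derive. exact I.
      * apply continuous_calI. lra.
Qed.

End Areal.

(** * The right-hand side of the system *)

Section System.

Variables (OL z0 c : R) (E R0 : R -> R) (X0 : state).
Hypotheses (hOL : 0 <= OL <= 1) (hz0 : 0 < z0) (hc : 0 < c).
Hypotheses (hE : forall r, E r = r ^ 2 / 2) (hR0 : forall r, R0 r = c * r).
Hypothesis hrad : rad X0 = Rof OL z0 / c.
Hypothesis hmas : 0 < mas X0.

Lemma rad_base_pos : 0 < rad X0.
Proof. rewrite hrad. apply Rdiv_lt_0_compat; [apply Rof_pos; assumption | exact hc]. Qed.

Lemma E_pos (r : R) : 0 < r -> 0 < E r.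
Proof. intros Hr. rewrite hE. nra. Qed.

Lemma R0_base : R0 (rad X0) = Rof OL z0.
Proof. rewrite hR0, hrad. field. lra. Qed.

Lemma Derive_E (r : R) : Derive E r = r.
Proof.
  rewrite (Derive_ext _ _ _ hE). apply is_derive_unique. auto_derive; [exact I | field].
Qed.

Lemma Derive_R0 (r : R) : Derive R0 r = c.
Proof.
  rewrite (Derive_ext _ _ _ hR0). apply is_derive_unique. auto_derive; [exact I | ring].
Qed.

Lemma locally_state_pos (s0 : R) :
  locally (s0, X0) (fun p => 0 < rad (snd p) /\ 0 < mas (snd p)).
Proof.
  apply filter_and.
  - apply (proj1 (lip_at_rad s0 X0) (fun y => 0 < y)).
    apply (open_gt 0), rad_base_pos.
  - apply (proj1 (lip_at_mas s0 X0) (fun y => 0 < y)).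
    apply (open_gt 0), hmas.
Qed.

Lemma locally_domain :
  locally (z0, X0) (fun p =>
    0 < Rof OL (fst p) /\ 0 < rad (snd p) /\ 0 < mas (snd p)).
Proof.
  apply filter_and; [|apply locally_state_pos].
  apply (proj1 (lip_at_time z0 X0 (Rof OL) (continuous_Rof OL hOL z0 hz0))
           (fun y => 0 < y)).
  apply (open_gt 0), Rof_pos; assumption.
Qed.

Lemma lip_at_E (s0 : R) : lip_at s0 X0 (fun _ X => E (rad X)).
Proof.
  apply lip_at_ext_loc with (fun _ X => rad X ^ 2 / 2).
  - apply filter_forall. intros p. symmetry. apply hE.
  - apply lip_at_div; [lra | apply lip_at_pow2, lip_at_rad | apply lip_at_const].
Qed.

Lemma lip_at_R0 (s0 : R) : lip_at s0 X0 (fun _ X => R0 (rad X)).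
Proof.
  apply lip_at_ext_loc with (fun _ X => c * rad X).
  - apply filter_forall. intros p. symmetry. apply hR0.
  - apply lip_at_mult; [apply lip_at_const | apply lip_at_rad].
Qed.

Lemma lip_at_Rof : lip_at z0 X0 (fun z _ => Rof OL z).
Proof. apply lip_at_time, continuous_Rof; assumption. Qed.

Lemma lip_at_R_z : lip_at z0 X0 (fun z _ => R_z OL z).
Proof. apply lip_at_time, continuous_R_z; assumption. Qed.

Lemma lip_at_Derive_E : lip_at z0 X0 (fun _ X => Derive E (rad X)).
Proof.
  apply lip_at_ext_loc with (fun _ X => rad X); [|apply lip_at_rad].
  apply filter_forall. intros p. symmetry. apply Derive_E.
Qed.

Lemma lip_at_Derive_R0 : lip_at z0 X0 (fun _ X => Derive R0 (rad X)).
Proof.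
  apply lip_at_ext_loc with (fun _ _ => c); [|apply lip_at_const].
  apply filter_forall. intros p. symmetry. apply Derive_R0.
Qed.

Lemma lip_at_dJ_endpoint (f : R -> state -> R) :
  0 < f z0 X0 -> lip_at z0 X0 f ->
  lip_at z0 X0 (fun z X => sqrt (f z X / (f z X * E (rad X) + mas X))).
Proof.
  intros H0 Hf. assert (HE := E_pos _ rad_base_pos).
  assert (HD : 0 < f z0 X0 * E (rad X0) + mas X0) by nra.
  apply lip_at_sqrt; [apply Rdiv_lt_0_compat; assumption|].
  apply lip_at_div; [lra | exact Hf |].
  apply lip_at_plus; [|apply lip_at_mas].
  apply lip_at_mult; [exact Hf | apply lip_at_E].
Qed.

Lemma lip_at_dJ_R :
  lip_at z0 X0 (fun z X =>
    dJ_R c (Rof OL z) (R0 (rad X)) (mas X) (E (rad X)) (tim X)).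
Proof.
  apply lip_at_ext_loc with (fun z X =>
    - sqrt (Rof OL z / (Rof OL z * E (rad X) + mas X))).
  - generalize locally_domain. apply filter_imp. intros [z X] [H1 [H2 H3]].
    simpl in *. symmetry.
    apply dJ_R_eq; auto using E_pos. rewrite hR0. nra.
  - apply lip_at_opp.
    apply (lip_at_dJ_endpoint (fun z _ => Rof OL z));
      [apply Rof_pos; assumption | apply lip_at_Rof].
Qed.

Lemma lip_at_dJ_R0 :
  lip_at z0 X0 (fun z X =>
    dJ_R0 c (Rof OL z) (R0 (rad X)) (mas X) (E (rad X)) (tim X)).
Proof.
  apply lip_at_ext_loc with (fun z X =>
    sqrt (R0 (rad X) / (R0 (rad X) * E (rad X) + mas X))).
  - generalize locally_domain. apply filter_imp. intros [z X] [H1 [H2 H3]].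
    simpl in *. symmetry.
    apply dJ_R0_eq; auto using E_pos. rewrite hR0. nra.
  - apply (lip_at_dJ_endpoint (fun _ X => R0 (rad X))); [|apply lip_at_R0].
    rewrite R0_base. apply Rof_pos; assumption.
Qed.

(** The common form of the derivatives of J with respect to E and M. The
    initial condition r = R[z0] / c makes R0(r) equal to R[z0], so that
    [lip_at_RInt] applies. *)
Lemma lip_at_RInt_param_slope (a b : state -> R -> R) (u : state -> R) :
  (forall X x, 0 < rad X -> 0 < mas X -> 0 < x -> 0 < a X x /\ 0 < b X x) ->
  (forall X x, continuous (a X) x /\ continuous (b X) x) ->
  (forall X, 0 < rad X -> 0 < mas X -> 0 < u X) ->
  (forall s0, lip_at s0 X0 (fun x X => a X x)) ->
  (forall s0, lip_at s0 X0 (fun x X => b X x)) ->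
  (forall s0, lip_at s0 X0 (fun _ X => u X)) ->
  lip_at z0 X0 (fun z X =>
    RInt (param_slope (a X) (b X) (u X)) (R0 (rad X)) (Rof OL z)).
Proof.
  intros Hpos Hcont Hu La Lb Lu.
  assert (Hr := rad_base_pos). assert (HR := Rof_pos OL hOL z0 hz0).
  apply (lip_at_RInt z0 (Rof OL z0) X0
    (fun x X => param_slope (a X) (b X) (u X) x) (fun _ X => R0 (rad X))
    (fun z _ => Rof OL z)).
  - apply R0_base.
  - reflexivity.
  - assert (Hs : locally (Rof OL z0, X0) (fun p : R * state => 0 < fst p)).
    { apply (continuous_fst (Rof OL z0) X0 (fun y => 0 < y)).
      apply (open_gt 0), HR. }
    generalize (filter_and _ _ Hs (locally_state_pos (Rof OL z0))).
    apply filter_imp. intros [s X] [H1 [H2 H3]]. simpl in *.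
    apply continuous_param_slope_r; auto; intros x; try apply Hcont;
    intros Hx; apply Hpos; assumption.
  - destruct (Hpos X0 (Rof OL z0) Hr hmas HR) as [Pa Pb].
    assert (Pu := Hu X0 Hr hmas).
    assert (PD : 0 < a X0 (Rof OL z0) * u X0 + b X0 (Rof OL z0)) by nra.
    assert (Pq := Rdiv_lt_0_compat _ _ HR PD).
    assert (Ps := sqrt_lt_R0 _ Pq).
    assert (LD : lip_at (Rof OL z0) X0 (fun x X => a X x * u X + b X x)).
    { apply lip_at_plus; [apply lip_at_mult|]; auto. }
    assert (Lx : lip_at (Rof OL z0) X0 (fun x (_ : state) => x)).
    { apply (lip_at_time _ _ (fun x => x)), continuous_id. }
    unfold param_slope. apply lip_at_div.
    + lra.
    + apply lip_at_opp, lip_at_div.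
      * simpl. nra.
      * apply lip_at_mult; auto.
      * apply lip_at_pow2, LD.
    + apply lip_at_mult; [apply lip_at_const|].
      apply lip_at_sqrt; [exact Pq|].
      apply lip_at_div; [lra | exact Lx | exact LD].
  - apply lip_at_R0.
  - apply lip_at_Rof.
Qed.

Lemma lip_at_dJ_E :
  lip_at z0 X0 (fun z X =>
    dJ_E c (Rof OL z) (R0 (rad X)) (mas X) (E (rad X)) (tim X)).
Proof.
  apply lip_at_ext_loc with (fun z X =>
    - RInt (param_slope (fun x => x) (fun _ => mas X) (E (rad X)))
        (R0 (rad X)) (Rof OL z)).
  - generalize locally_domain. apply filter_imp. intros [z X] [H1 [H2 H3]].
    simpl in *. symmetry.
    apply dJ_E_eq; auto using E_pos. rewrite hR0. nra.
  - apply lip_at_opp.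
    apply (lip_at_RInt_param_slope (fun _ x => x) (fun X _ => mas X)
             (fun X => E (rad X))).
    + auto.
    + intros; split; [apply continuous_id | apply continuous_const].
    + intros; apply E_pos; assumption.
    + intros; apply (lip_at_time _ _ (fun x => x)), continuous_id.
    + intros; apply lip_at_mas.
    + apply lip_at_E.
Qed.

Lemma lip_at_dJ_M :
  lip_at z0 X0 (fun z X =>
    dJ_M c (Rof OL z) (R0 (rad X)) (mas X) (E (rad X)) (tim X)).
Proof.
  apply lip_at_ext_loc with (fun z X =>
    - RInt (param_slope (fun _ => 1) (fun x => x * E (rad X)) (mas X))
        (R0 (rad X)) (Rof OL z)).
  - generalize locally_domain. apply filter_imp. intros [z X] [H1 [H2 H3]].
    simpl in *. symmetry.
    apply dJ_M_eq; auto using E_pos. rewrite hR0. nra.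
  - apply lip_at_opp.
    apply (lip_at_RInt_param_slope (fun _ _ => 1) (fun X x => x * E (rad X)) mas).
    + intros X x H1 _ Hx. assert (H := E_pos _ H1). split; nra.
    + intros X x; split; [apply continuous_const|].
      apply (continuous_mult (K := R_AbsRing));
        [apply continuous_id | apply continuous_const].
    + auto.
    + intros; apply lip_at_const.
    + intros; apply lip_at_mult; [|apply lip_at_E].
      apply (lip_at_time _ _ (fun x => x)), continuous_id.
    + intros; apply lip_at_mas.
Qed.

Hypothesis hden :
  denominators_nonzero OL c E R0 z0 (rad X0) (tim X0) (mas X0).

Lemma lip_at_calF :
  lip_at z0 X0 (fun z X => calF c E R0 (Rof OL z) (rad X) (tim X) (mas X)).
Proof.
  destruct hden as [_ [_ [HJ _]]]. unfold calF.
  apply lip_at_div.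
  - apply Ropp_neq_0_compat, HJ.
  - apply lip_at_plus; apply lip_at_mult;
      auto using lip_at_Derive_E, lip_at_Derive_R0, lip_at_dJ_E, lip_at_dJ_R0.
  - apply lip_at_opp, lip_at_dJ_R.
Qed.

Lemma lip_at_calG :
  lip_at z0 X0 (fun z X => calG c E R0 (Rof OL z) (rad X) (tim X) (mas X)).
Proof.
  destruct hden as [_ [_ [HJ _]]]. unfold calG.
  apply lip_at_div.
  - apply Ropp_neq_0_compat, HJ.
  - apply lip_at_dJ_M.
  - apply lip_at_opp, lip_at_dJ_R.
Qed.

Lemma lip_at_sqrt_1_2E : lip_at z0 X0 (fun _ X => sqrt (1 + 2 * E (rad X))).
Proof.
  assert (H := E_pos _ rad_base_pos).
  apply lip_at_sqrt; [lra|].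
  apply lip_at_plus; [apply lip_at_const|].
  apply lip_at_mult; [apply lip_at_const | apply lip_at_E].
Qed.

Lemma lip_at_sqrt_2E_2M :
  lip_at z0 X0 (fun z X => sqrt (2 * E (rad X) + 2 * mas X / Rof OL z)).
Proof.
  assert (H := E_pos _ rad_base_pos). assert (HR := Rof_pos OL hOL z0 hz0).
  assert (Hq : 0 < 2 * mas X0 / Rof OL z0) by (apply Rdiv_lt_0_compat; lra).
  apply lip_at_sqrt; [lra|].
  apply lip_at_plus.
  - apply lip_at_mult; [apply lip_at_const | apply lip_at_E].
  - apply lip_at_div; [lra | | apply lip_at_Rof].
    apply lip_at_mult; [apply lip_at_const | apply lip_at_mas].
Qed.

Lemma lip_at_den1 :
  lip_at z0 X0 (fun z X => den1 E (Rof OL z) (rad X) (mas X)).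
Proof.
  apply lip_at_minus; [|apply lip_at_sqrt_1_2E].
  apply lip_at_mult; [apply lip_at_const | apply lip_at_sqrt_2E_2M].
Qed.

Lemma lip_at_den2 :
  lip_at z0 X0 (fun z X => den2 c E R0 (Rof OL z) (rad X) (tim X) (mas X)).
Proof.
  apply lip_at_minus; [|apply lip_at_calF].
  apply lip_at_mult; [|apply lip_at_Rof].
  apply lip_at_mult; [apply lip_at_calG | apply lip_at_Derive_E].
Qed.

Lemma lip_at_Acoef :
  lip_at z0 X0 (fun z X => Acoef E (Rof OL z) z (rad X) (mas X)).
Proof.
  apply lip_at_mult; [|apply lip_at_sqrt_1_2E].
  apply lip_at_div.
  - lra.
  - apply lip_at_mult; [apply lip_at_const | apply lip_at_sqrt_2E_2M].
  - apply lip_at_plus; [apply lip_at_const|].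
    apply (lip_at_time _ _ (fun z => z)), continuous_id.
Qed.

Lemma lip_at_common_denominator :
  lip_at z0 X0 (fun z X => Rof OL z * den1 E (Rof OL z) (rad X) (mas X)
    * den2 c E R0 (Rof OL z) (rad X) (tim X) (mas X)).
Proof.
  apply lip_at_mult; [apply lip_at_mult|];
    auto using lip_at_Rof, lip_at_den1, lip_at_den2.
Qed.

Lemma common_denominator_neq0 :
  Rof OL z0 * den1 E (Rof OL z0) (rad X0) (mas X0)
    * den2 c E R0 (Rof OL z0) (rad X0) (tim X0) (mas X0) <> 0.
Proof.
  destruct hden as [_ [HR [_ [H1 H2]]]].
  apply Rmult_integral_contrapositive_currified; [|exact H2].
  apply Rmult_integral_contrapositive_currified; assumption.
Qed.

Lemma lip_at_rhs_r :
  lip_at z0 X0 (fun z X => rhs_r OL c E R0 z (rad X) (tim X) (mas X)).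
Proof.
  assert (H2 : den2 c E R0 (Rof OL z0) (rad X0) (tim X0) (mas X0) <> 0)
    by apply hden.
  unfold rhs_r. apply lip_at_minus; apply lip_at_div;
    auto using lip_at_den2, lip_at_common_denominator, common_denominator_neq0.
  - apply lip_at_mult; [apply lip_at_mult|];
      auto using lip_at_calG, lip_at_Acoef, lip_at_Rof.
  - apply lip_at_mult; [apply lip_at_mult|];
      auto using lip_at_R_z, lip_at_sqrt_1_2E.
    apply lip_at_minus; [apply lip_at_mult|];
      auto using lip_at_mas, lip_at_calG, lip_at_Rof.
Qed.

Lemma lip_at_rhs_t :
  lip_at z0 X0 (fun z X => rhs_t OL E z (rad X) (mas X)).
Proof.
  assert (H1 : den1 E (Rof OL z0) (rad X0) (mas X0) <> 0) by apply hden.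
  apply lip_at_div; auto using lip_at_den1.
  apply lip_at_mult; [apply lip_at_const | apply lip_at_R_z].
Qed.

Lemma lip_at_rhs_M :
  lip_at z0 X0 (fun z X => rhs_M OL c E R0 z (rad X) (tim X) (mas X)).
Proof.
  assert (H2 : den2 c E R0 (Rof OL z0) (rad X0) (tim X0) (mas X0) <> 0)
    by apply hden.
  unfold rhs_M. apply lip_at_minus; apply lip_at_div;
    auto using lip_at_den2, lip_at_common_denominator, common_denominator_neq0.
  - apply lip_at_mult; [apply lip_at_mult|];
      auto using lip_at_calF, lip_at_Acoef, lip_at_Rof, lip_at_opp.
  - apply lip_at_mult; [apply lip_at_mult|];
      auto using lip_at_R_z, lip_at_sqrt_1_2E.
    apply lip_at_minus; apply lip_at_mult;
      auto using lip_at_mas, lip_at_calF, lip_at_Rof, lip_at_pow2, lip_at_Derive_E.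
Qed.

End System.

(** * Uniqueness of the light-cone system *)

Theorem theorem4 (OL z0 c : R) (E R0 : R -> R)
  (hOL : 0 <= OL <= 1) (hz0 : 0 < z0) (hc : 0 < c)
  (hE : forall r : R, E r = r ^ 2 / 2) (hR0 : forall r : R, R0 r = c * r)
  (hzL : forall zL : R, is_zLambda OL zL -> z0 <> zL)
  (a1 b1 a2 b2 : Rbar) (r1 t1 M1 r2 t2 M2 : R -> R)
  (hI1 : in_open a1 b1 z0) (hI2 : in_open a2 b2 z0)
  (hS1 : smooth_solution OL c E R0 a1 b1 r1 t1 M1)
  (hS2 : smooth_solution OL c E R0 a2 b2 r2 t2 M2)
  (hX1 : initial_condition OL c z0 r1 t1 M1)
  (hX2 : initial_condition OL c z0 r2 t2 M2) :
  locally z0 (fun z => r1 z = r2 z /\ t1 z = t2 z /\ M1 z = M2 z).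
Proof.
  destruct hS1 as [_ [_ [_ Hode1]]], hS2 as [_ [_ [_ Hode2]]].
  destruct hX1 as [Ir1 [It1 IM1]], hX2 as [Ir2 [It2 IM2]].
  set (X0 := (r1 z0, t1 z0, M1 z0) : state).
  assert (hrad : rad X0 = Rof OL z0 / c) by exact Ir1.
  assert (hmas : 0 < mas X0).
  { change (0 < M1 z0). rewrite IM1.
    assert (H := Rof_pos OL hOL z0 hz0).
    assert (H' := pow_lt _ 3 (Rdiv_lt_0_compat _ _ H hc)). lra. }
  assert (hden : denominators_nonzero OL c E R0 z0 (rad X0) (tim X0) (mas X0))
    by apply (Hode1 z0 hI1).
  apply (ode_unique z0 X0
    (fun z X => rhs_r OL c E R0 z (rad X) (tim X) (mas X))
    (fun z X => rhs_t OL E z (rad X) (mas X))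
    (fun z X => rhs_M OL c E R0 z (rad X) (tim X) (mas X))).
  - apply lip_at_rhs_r; assumption.
  - apply lip_at_rhs_t with c R0; assumption.
  - apply lip_at_rhs_M; assumption.
  - destruct hI1 as [Ha Hb]. apply locally_interval with a1 b1; trivial.
    intros z Hza Hzb. apply Hode1. split; assumption.
  - destruct hI2 as [Ha Hb]. apply locally_interval with a2 b2; trivial.
    intros z Hza Hzb. apply Hode2. split; assumption.
  - reflexivity.
  - unfold X0. rewrite Ir1, It1, IM1, Ir2, It2, IM2. reflexivity.
Qed.
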